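(* Let $\mathcal{P}$ be a PTRS and let $\mathfrak{T}$ be a $\to_{\mathcal{P}}$-RST with $\operatorname{h}(\mathfrak{T})>0$ whose root is labeled with a linear term $t$. If $\sum_{v\text{ leaf of }\mathfrak{T}} p_v\cdot \operatorname{maxNO}(t,t_v) > 1$, then $\mathcal{P}$ is not AST. If $\sum_{v\text{ leaf of }\mathfrak{T}} p_v\cdot \operatorname{maxNO}(t,t_v) \ge 1$, then $\mathcal{P}$ is not PAST.
   Context: Terms over a finite signature $\Sigma$ and variables $\mathcal{V}$; substitutions have finite domain and extend homomorphically. $\operatorname{Pos}(s)$ is the set of positions of $s$ (words over positive integers, $\varepsilon$ the root), $s|_\pi$ the subterm at $\pi$, $s[r]_\pi$ replacement; $\operatorname{Pos}_\Sigma(t)$ is the set of positions of $t$ carrying a function symbol. A term $t$ is linear if each variable occurs at most once in $t$. A PTRS is a finite set of rules $\ell\to\{p_1:r_1,\dots,p_k:r_k\}$ ($\ell\notin\mathcal{V}$, $p_j>0$ summing to $1$, variables of each $r_j$ occur in $\ell$), inducing $s\to_{\mathcal{P}}\{p_1:s[r_1\sigma]_\pi,\dots,p_k:s[r_k\sigma]_\pi\}$ whenever $s|_\pi=\ell\sigma$. A $\to_{\mathcal{P}}$-RST is a (possibly infinite) tree whose nodes $v$ are labeled $(p_v:t_v)$ with $p_v\in(0,1]$, terms $t_v$, root probability $1$, and each non-leaf node $v$ with children $w_1,\dots,w_k$ satisfying $t_v\to_{\mathcal{P}}\{\tfrac{p_{w_1}}{p_v}:t_{w_1},\dots,\tfrac{p_{w_k}}{p_v}:t_{w_k}\}$;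 leaves need not be normal forms. $\operatorname{h}(\mathfrak{T})$ is the supremum of node depths. For a $\to_{\mathcal{P}}$-RST $\mathfrak{T}$: $|\mathfrak{T}|=\sum_{v\text{ leaf}}p_v$; $\operatorname{edl}(\mathfrak{T})=\infty$ if $|\mathfrak{T}|<1$, else $\sum_{v\text{ leaf}}\operatorname{d}(v)p_v$ with $\operatorname{d}$ the depth. $\mathcal{P}$ is AST if $|\mathfrak{T}|=1$ for all $\to_{\mathcal{P}}$-RSTs, and PAST if $\operatorname{edl}(\mathfrak{T})<\infty$ for all of them. Term occurrences: $t$ occurs in $s$ at position $\pi$ if $s|_\pi=t\sigma$ for some substitution $\sigma$. Positions $\pi_1,\pi_2$ are overlapping w.r.t. $t$ if there is $\tau\in\operatorname{Pos}_\Sigma(t)$ with $\pi_1=\pi_2.\tau$ or $\pi_2=\pi_1.\tau$. $\operatorname{NO}(t,s)$ is the set of all sets $S\subseteq\operatorname{Pos}(s)$ such that $t$ occurs in $s$ at every $\pi\in S$ and any two distinct positions of $S$ are non-overlapping w.r.t. $t$. $\operatorname{maxNO}(t,s)=\max_{S\in\operatorname{NO}(t,s)}|S|$. *)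

(* Defs.v *)
From HB Require Import structures.
From mathcomp Require Import all_boot all_order all_algebra.
From mathcomp Require Import finmap.
From mathcomp Require Import all_classical all_reals all_analysis.

Set Implicit Arguments.
Unset Strict Implicit.
Unset Printing Implicit Defensive.

Import Order.TTheory GRing.Theory Num.Theory.
Local Open Scope classical_set_scope.
Local Open Scope ring_scope.

Record signature := Signature {
  symbol : finType;
  arity : symbol -> nat
}.

(* Finite functions rather than tuples are used for the arguments because      *)
(* [{ffun 'I_n -> T}] is strictly positive in [T].                             *)
Inductive term (Sg : signature) (V : eqType) : Type :=
| Var of V
| App (f : symbol Sg) of {ffun 'I_(arity f) -> term Sg V}.

Arguments Var {Sg V} _.
Arguments App {Sg V} f _.

(* The list of variables of a term, one entry per occurrence. *)
Fixpoint vars (Sg : signature) (V : eqType) (t : term Sg V) : seq V :=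
  match t with
  | Var x => [:: x]
  | App f a => flatten [seq vars (a i) | i <- enum 'I_(arity f)]
  end.

Definition linear_term (Sg : signature) (V : eqType) (t : term Sg V) : bool :=
  uniq (vars t).

Record substitution (Sg : signature) (V : eqType) := Substitution {
  subst_fun :> V -> term Sg V;
  subst_dom : finite_set [set x | subst_fun x <> Var x]
}.

Fixpoint subst (Sg : signature) (V : eqType) (sigma : V -> term Sg V)
    (t : term Sg V) : term Sg V :=
  match t with
  | Var x => sigma x
  | App f a => App f [ffun i => subst sigma (a i)]
  end.

(* Positions are words over the positive integers: the letter [i.+1] selects   *)
(* the argument of index [i : 'I_(arity f)], and the letter [0] never occurs.  *)
Definition position := seq nat.

Fixpoint pos_seq (Sg : signature) (V : eqType) (t : term Sg V) : seq position :=
  match t with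
  | Var _ => [:: [::]]
  | App f a => [::] ::
      flatten [seq [seq (nat_of_ord i).+1 :: p | p <- pos_seq (a i)]
              | i <- enum 'I_(arity f)]
  end.

Definition Pos (Sg : signature) (V : eqType) (t : term Sg V) : {fset position} :=
  [fset p in pos_seq t]%fset.

(* [None] when [p] is not a position of [t]. *)
Fixpoint subterm (Sg : signature) (V : eqType) (t : term Sg V) (p : position)
    : option (term Sg V) :=
  match p, t with
  | [::], _ => Some t
  | i.+1 :: q, App f a => if insub i is Some j then subterm (a j) q else None
  | _, _ => None
  end.

(* The term itself when [p] is not a position of [t]. *)
Fixpoint replace (Sg : signature) (V : eqType) (t r : term Sg V) (p : position)
    : term Sg V :=
  match p, t with
  | [::], _ => r
  | i.+1 :: q, App f a =>
      App f [ffun j => if nat_of_ord j == i then replace (a j) r q else a j]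
  | _, _ => t
  end.

Definition PosSigma (Sg : signature) (V : eqType) (t : term Sg V)
    : set position :=
  [set p | exists f a, subterm t p = Some (App f a)].

(* A finite multi-distribution {p_1 : a_1, ..., p_k : a_k}, given by a list. *)
Definition multidist (R : realType) (A : Type) := seq (R * A).

Record rule (R : realType) (Sg : signature) (V : eqType) := Rule {
  lhs : term Sg V;
  rhs : multidist R (term Sg V);
  lhs_nonvar : forall x, lhs <> Var x;
  rhs_pos : all (fun pr => 0 < pr.1) rhs;
  rhs_sum : \sum_(pr <- rhs) pr.1 = 1;
  rhs_vars : all (fun pr => all (mem (vars lhs)) (vars pr.2)) rhs
}.

Record ptrs (R : realType) (Sg : signature) (V : eqType) := PTRS {
  rules :> set (rule R Sg V);
  rules_finite : finite_set rules
}.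

Definition rstep (R : realType) (Sg : signature) (V : eqType) (P : ptrs R Sg V)
    (s : term Sg V) (mu : multidist R (term Sg V)) : Prop :=
  exists (rl : rule R Sg V) (p : position) (sigma : substitution Sg V),
    [/\ rules P rl,
        subterm s p = Some (subst sigma (lhs rl)) &
        mu = [seq (pr.1, replace s (subst sigma pr.2) p) | pr <- rhs rl]].

(* A rewrite sequence tree. Nodes are addressed by words over nat: [::] is the *)
(* root and a node [v] with k children has the children [rcons v i], i < k,    *)
(* enumerated in the order of the rule applied at [v]. The values of           *)
(* [node_prob] and [node_term] outside [nodes] are irrelevant.                 *)
Record rst (R : realType) (Sg : signature) (V : eqType) (P : ptrs R Sg V) := RST {
  nodes : set (seq nat);
  node_prob : seq nat -> R;
  node_term : seq nat -> term Sg V;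
  rst_root : nodes [::];
  rst_parent : forall v i, nodes (rcons v i) -> nodes v;
  rst_prob_range : forall v, nodes v -> 0 < node_prob v <= 1;
  rst_prob_root : node_prob [::] = 1;
  rst_step : forall v, nodes v -> (exists i, nodes (rcons v i)) ->
    exists2 k : nat,
      (forall i, nodes (rcons v i) <-> (i < k)%N) &
      rstep P (node_term v)
        [seq (node_prob (rcons v i) / node_prob v, node_term (rcons v i))
        | i <- iota 0 k]
}.

Definition depth (v : seq nat) : nat := size v.

Definition leaves (R : realType) (Sg : signature) (V : eqType)
    (P : ptrs R Sg V) (T : rst P) : set (seq nat) :=
  [set v | nodes T v /\ forall i, ~ nodes T (rcons v i)].

Definition height (R : realType) (Sg : signature) (V : eqType)
    (P : ptrs R Sg V) (T : rst P) : \bar R :=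
  ereal_sup [set ((depth v)%:R : R)%:E | v in nodes T].

Definition conv_prob (R : realType) (Sg : signature) (V : eqType)
    (P : ptrs R Sg V) (T : rst P) : \bar R :=
  (\esum_(v in leaves T) (node_prob T v)%:E)%E.

Definition edl (R : realType) (Sg : signature) (V : eqType)
    (P : ptrs R Sg V) (T : rst P) : \bar R :=
  (if conv_prob T < 1 then +oo
   else \esum_(v in leaves T) ((depth v)%:R * node_prob T v)%:E)%E.

Definition AST (R : realType) (Sg : signature) (V : eqType)
    (P : ptrs R Sg V) : Prop :=
  forall T : rst P, conv_prob T = 1%E.

Definition PAST (R : realType) (Sg : signature) (V : eqType)
    (P : ptrs R Sg V) : Prop :=
  forall T : rst P, (edl T < +oo)%E.

Definition occurs_at (Sg : signature) (V : eqType) (t s : term Sg V)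
    (p : position) : Prop :=
  exists sigma : substitution Sg V, subterm s p = Some (subst sigma t).

Definition overlapping (Sg : signature) (V : eqType) (t : term Sg V)
    (p1 p2 : position) : Prop :=
  exists2 tau, PosSigma t tau & p1 = p2 ++ tau \/ p2 = p1 ++ tau.

Definition NO (Sg : signature) (V : eqType) (t s : term Sg V)
    : set {fset position} :=
  [set S : {fset position} |
    [/\ (S `<=` Pos s)%fset,
        (forall p, p \in S -> occurs_at t s p) &
        (forall p1 p2, p1 \in S -> p2 \in S -> p1 <> p2 ->
           ~ overlapping t p1 p2)]].

(* Every member of [NO t s] is a subset of [Pos s], so ranging over the finite *)
(* power set of [Pos s] loses nothing.                                         *)
Definition maxNO (Sg : signature) (V : eqType) (t s : term Sg V) : nat :=
  (\max_(S <- fpowerset (Pos s) | S \in NO t s) #|` S|)%N.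

(* Main.v *)
(* Keep a set S of pairwise non-overlapping occurrences of t in the current
   term. Running T at an innermost member of S and reaching the leaf v replaces
   it by maxNO(t,t_v) new occurrences; by linearity of t the members of S above
   still match, and the other ones are untouched. Iterating until S is empty
   gives an RST whose leaves are the concatenations of the leaves of T along
   which a random walk, started at 1 with steps maxNO(t,t_v) - 1, first hits 0.
   If the mean of maxNO(t,t_v) exceeds 1, some theta < 1 makes theta^|S| a
   supermartingale, so 0 is hit with probability at most theta. If the mean is
   at least 1 and 0 is hit almost surely, the expected hitting time e satisfies
   e >= 1 + e, hence is infinite. *)

Require Import Defs.
From HB Require Import structures.
From mathcomp Require Import all_boot all_order all_algebra.
From mathcomp Require Import finmap.
From mathcomp Require Import all_classical all_reals all_analysis.
From mathcomp Require Import ring lra.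

Set Implicit Arguments.
Unset Strict Implicit.
Unset Printing Implicit Defensive.

Import Order.TTheory GRing.Theory Num.Theory.
Local Open Scope classical_set_scope.
Local Open Scope ring_scope.

(** * Terms, positions and linear matching *)

Section Terms.
Variables (Sg : signature) (V : eqType).
Implicit Types (s t u : term Sg V) (p q : position).

(** The arguments of [App] are nested in a finite function; the explicit [fix] supplies an induction
    hypothesis for each of them. *)
Lemma term_nested_ind (Q : term Sg V -> Prop) :
  (forall x, Q (Var x)) ->
  (forall f (a : {ffun 'I_(arity f) -> term Sg V}),
     (forall i, Q (a i)) -> Q (App f a)) -> forall t, Q t.
Proof.
move=> QV QA; fix IH 1 => -[x|f a]; first exact: QV.
by apply: QA => i; apply: IH.
Qed.

Lemma subterm_nil s : subterm s [::] = Some s. Proof. by case: s. Qed.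

Lemma replace_nil s r : replace s r [::] = r. Proof. by case: s. Qed.

Lemma subterm_cat s p q :
  subterm s (p ++ q) = obind (fun u => subterm u q) (subterm s p).
Proof.
elim: p s => [|[|i] p IH] [x|f a] //=; by case: insub => [j|] /=.
Qed.

Lemma subst_Var t : subst Var t = t.
Proof.
elim/term_nested_ind: t => [x|f a IH] //=.
by congr App; apply/ffunP => i; rewrite ffunE.
Qed.

Lemma eq_in_subst (sigma tau : V -> term Sg V) t :
  {in vars t, sigma =1 tau} -> subst sigma t = subst tau t.
Proof.
elim/term_nested_ind: t => [x|f a IH] /= st.
  by apply: st; rewrite inE.
congr App; apply/ffunP => i; rewrite !ffunE; apply: IH => x xi; apply: st.
by apply/flatten_mapP; exists i; rewrite ?mem_enum.
Qed.

Lemma subst_comp (sigma tau : V -> term Sg V) t :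
  subst sigma (subst tau t) = subst (fun x => subst sigma (tau x)) t.
Proof.
elim/term_nested_ind: t => [x|f a IH] //=.
by congr App; apply/ffunP => i; rewrite !ffunE.
Qed.

Lemma subterm_subst (sigma : V -> term Sg V) t p u :
  subterm t p = Some u -> subterm (subst sigma t) p = Some (subst sigma u).
Proof.
elim: p t => [|[|i] p IH] t; first (by rewrite !subterm_nil => -[<-]);
  case: t => [x|f a] //=.
by case: insubP => [j _ _|] //=; rewrite ffunE; exact: IH.
Qed.

Lemma comp_subst_dom (sigma tau : substitution Sg V) :
  finite_set [set x | subst sigma (tau x) <> Var x].
Proof.
apply: (@sub_finite_set _ _
  ([set x | tau x <> Var x] `|` [set x | sigma x <> Var x])).
  move=> x /=; have [->/=|] := pselect (tau x = Var x); first by right.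
  by left.
by rewrite finite_setU; split; exact: subst_dom.
Qed.

Definition subst_comp_fin (sigma tau : substitution Sg V) : substitution Sg V :=
  Substitution (comp_subst_dom sigma tau).

Lemma id_subst_dom : finite_set [set x | Var x <> Var x :> term Sg V].
Proof. by apply: (@sub_finite_set _ _ set0) => // x /=. Qed.

Definition id_subst : substitution Sg V := Substitution id_subst_dom.

Lemma upd_subst_dom (sigma : substitution Sg V) x u :
  finite_set [set y | (if y == x then u else sigma y) <> Var y].
Proof.
apply: (@sub_finite_set _ _ ([set x] `|` [set y | sigma y <> Var y])).
  by move=> y /=; have [->|_] := eqVneq y x; [left | right].
by rewrite finite_setU; split=> //; exact: subst_dom.
Qed.

Definition upd_subst (sigma : substitution Sg V) x u : substitution Sg V :=
  Substitution (upd_subst_dom sigma x u).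

Lemma replace_self s p u : subterm s p = Some u -> replace s u p = s.
Proof.
elim: p s => [|[|i] p IH] [x|f a] //=; try by case.
case: insubP => [j _ ji|//] sj; congr App; apply/ffunP => k; rewrite ffunE.
case: eqP => // ki; apply: IH.
by have <- : j = k by apply: val_inj; rewrite /= ji ki.
Qed.

Lemma subterm_replace s p u r q : subterm s p = Some u ->
  subterm (replace s r p) (p ++ q) = subterm r q.
Proof.
elim: p s => [|[|i] p IH] [x|f a] //=.
by case: insubP => [j _ ji|//] sj; rewrite ffunE ji eqxx; exact: IH.
Qed.

Lemma replace_replace s p u r r' q : subterm s p = Some u ->
  replace (replace s r p) r' (p ++ q) = replace s (replace r r' q) p.
Proof.
elim: p s => [|[|i] p IH] [x|f a] //=.
case: insubP => [j _ ji|//] sj; congr App; apply/ffunP => k; rewrite !ffunE.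
case: eqP => // ki; apply: IH.
by have <- : j = k by apply: val_inj; rewrite /= ji ki.
Qed.

Lemma subterm_replace_above s r p q :
  subterm (replace s r (q ++ p)) q = omap (fun u => replace u r p) (subterm s q).
Proof.
elim: q s => [|[|i] q IH] s; first (by rewrite !subterm_nil);
  case: s => [x|f a] //=.
by case: insubP => [j _ ji|//] /=; rewrite ffunE ji eqxx.
Qed.

Lemma subterm_replace_parallel s r p q : ~~ prefix p q -> ~~ prefix q p ->
  subterm (replace s r p) q = subterm s q.
Proof.
elim: p q s => [|[|i] p IH] [|[|k] q] [x|f a] //= pq qp.
case: insubP => [j _ jk|//]; rewrite ffunE; case: eqP => // ji.
by apply: IH; move: pq qp; rewrite /= -jk /= ji !eqxx.
Qed.

Lemma replace_subst (sigma : V -> term Sg V) t r p u : subterm t p = Some u ->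
  replace (subst sigma t) (subst sigma r) p = subst sigma (replace t r p).
Proof.
elim: p t => [|[|i] p IH] t; first (by rewrite !replace_nil);
  case: t => [x|f a] //=.
case: insubP => [j _ ji|//] sj; congr App; apply/ffunP => k; rewrite !ffunE.
case: eqP => // ki; apply: IH.
by have <- : j = k by apply: val_inj; rewrite /= ji ki.
Qed.

(** A variable has no position strictly below its root. *)
Lemma PosSigma_cat t p q : PosSigma t (p ++ q) -> PosSigma t p.
Proof.
move=> [f [a]]; rewrite subterm_cat; case tp: (subterm t p) => [u|//] /=.
case: u tp => [x|g b] tp; last by exists g, b.
by case: q => [|[]].
Qed.

(* Linearity is what keeps the match: the variable of [t] lying above [p]
   occurs only once, so its value can absorb the replacement. *)
Lemma replace_linear_match t (sigma : substitution Sg V) r p :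
  linear_term t -> ~ PosSigma t p ->
  exists2 tau : substitution Sg V, replace (subst sigma t) r p = subst tau t &
    forall x, x \notin vars t -> tau x = sigma x.
Proof.
rewrite /linear_term.
elim/term_nested_ind: t p => [x|f a IH] p lin_t npos.
  exists (upd_subst sigma x (replace (sigma x) r p)) => /=; first by rewrite eqxx.
  by move=> y; rewrite inE => /negPf ->.
case: p npos => [npos|[|i] p npos] /=.
- by case: npos; exists f, a.
- by exists sigma.
have [il|il] := ltnP i (arity f); last first.
  exists sigma => //; congr App; apply/ffunP => k; rewrite !ffunE.
  by case: eqP => // ki; move: il; rewrite -ki leqNgt ltn_ord.
pose j := Ordinal il.
have jin : j \in enum 'I_(arity f) by rewrite mem_enum.
have uj : uniq (vars (a j)).
  move: lin_t => /=; elim: (enum _) jin => //= k e IHe.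
  by rewrite inE cat_uniq => /orP[/eqP <-|je] /and3P[]// _ _ /IHe; apply.
(* A variable shared by two distinct arguments would appear twice in the flattened list, against
   linearity. *)
have disj k x : x \in vars (a k) -> x \in vars (a j) -> k = j.
  move: lin_t => /= lin_t xk xj; apply/eqP; apply: contraTT lin_t => kj.
  have kin : k \in enum 'I_(arity f) by rewrite mem_enum.
  have mem b e : b \in e -> x \in vars (a b) ->
      x \in flatten [seq vars (a i) | i <- e].
    by move=> be xb; apply/flatten_mapP; exists b.
  elim: (enum _) jin kin => //= b e IHe; rewrite !inE cat_uniq !negb_and.
  move=> /orP[/eqP jb|je] /orP[/eqP kb|ke].
  - by rewrite jb kb eqxx in kj.
  - apply/orP; right; apply/orP; left; rewrite negbK; apply/hasP.
    by exists x; [exact: (mem k) | rewrite -jb].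
  - apply/orP; right; apply/orP; left; rewrite negbK; apply/hasP.
    by exists x; [exact: (mem j) | rewrite -kb].
  - by apply/orP; right; apply/orP; right; apply: IHe.
have njpos : ~ PosSigma (a j) p.
  move=> [g [b gb]]; apply: npos; exists g, b => /=.
  by rewrite insubT.
have [tau tauE tau_out] := IH j p uj njpos.
exists tau.
  congr App; apply/ffunP => k; rewrite !ffunE.
  case: eqP => [ki|ki].
    by have -> : k = j by apply: val_inj.
  (* The other arguments share no variable with [a j], so [tau] still agrees with [sigma] on
     them. *)
  apply: eq_in_subst => x xk; rewrite tau_out//; apply/negP => xj.
  by apply: ki; rewrite (disj _ _ xk xj).
move=> x xt; apply: tau_out; apply: contra xt => xj.
by apply/flatten_mapP; exists j.
Qed.

End Terms.

(** A redex at [q] in [t] becomes a redex at [p ++ q] for the composed substitution. This allows a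
    copy of a whole tree to run inside a larger term. *)
Lemma rstep_subst_ctx (R : realType) (Sg : signature) (V : eqType)
    (P : ptrs R Sg V) (s t u : term Sg V) (p : position)
    (sigma : substitution Sg V) (mu : multidist R (term Sg V)) :
  subterm s p = Some u -> rstep P t mu ->
  rstep P (replace s (subst sigma t) p)
    [seq (pr.1, replace s (subst sigma pr.2) p) | pr <- mu].
Proof.
move=> sp [rl [q [tau [rlP tq ->]]]].
have tq' := subterm_subst sigma tq; rewrite subst_comp in tq'.
exists rl, (p ++ q), (subst_comp_fin sigma tau); split => //.
  by rewrite (subterm_replace _ _ sp).
rewrite -map_comp; apply: eq_map => -[w r] /=; congr (_, _).
rewrite (replace_replace _ _ _ sp); congr replace.
by rewrite -subst_comp (replace_subst _ _ tq).
Qed.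

Lemma cat_injective (A : Type) (p : seq A) : injective (cat p).
Proof. by elim: p => [|x p IH] q r //= -[/IH]. Qed.

Lemma prefix_comparable (A : eqType) (p q r w : seq A) :
  p ++ r = q ++ w -> prefix p q || prefix q p.
Proof.
elim: p q => [|x p IH] [|y q] //= -[-> /IH].
by rewrite eqxx.
Qed.

(** * Non-overlapping occurrences under replacement *)

Lemma maxNO_attained (Sg : signature) (V : eqType) (t s : term Sg V) :
  exists2 S, NO t s S & #|` S|%fset = maxNO t s.
Proof.
have NO0 : NO t s fset0%fset by split=> //; exact: fsub0set.
rewrite /maxNO; apply: (big_ind (fun m => exists2 S, NO t s S & #|` S|%fset = m)).
- by exists fset0%fset; rewrite ?cardfs0.
- move=> m n [S NOS <-] [S' NOS' <-].
  by case: (leqP #|` S|%fset #|` S'|%fset) => _; [exists S' | exists S].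
- by move=> S; rewrite inE => NOS; exists S.
Qed.

(** A longest member of [S] has no proper extension in [S]. *)
Lemma innermost_position (S : {fset position}) : (0 < #|` S|%fset)%N ->
  exists2 p, p \in S & forall q, q \in S -> prefix p q -> q = p.
Proof.
rewrite cardfs_gt0 => /fset0Pn[p0 p0S].
have exP : exists n, has (fun p => size p == n) S.
  by exists (size p0); apply/hasP; exists p0.
have ubP n : has (fun p => size p == n) S -> (n <= \max_(p <- S) size p)%N.
  by move=> /hasP[p pS /eqP <-]; exact: leq_bigmax_seq.
case: (ex_maxnP exP ubP) => n /hasP[p pS /eqP pn] nmax.
exists p => // q qS /prefixP[r qE].
have : (size q <= n)%N by apply: nmax; apply/hasP; exists q.
rewrite qE size_cat pn; case: r qE => [_ _|i r _]; first by rewrite cats0.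
by rewrite /= addnS ltnNge leq_addr.
Qed.

(** The invariant of the iteration; [S] may be smaller than [maxNO t s]. *)
Definition nonoverlapping_occurrences (Sg : signature) (V : eqType)
    (t s : term Sg V) (S : {fset position}) : Prop :=
  (forall p, p \in S -> occurs_at t s p) /\
  (forall p q, p \in S -> q \in S -> p <> q -> ~ overlapping t p q).

(** Since [p] is innermost, every other member of [S] is parallel to [p], hence untouched, or above
    it. In the latter case non-overlap puts [p] at or below a variable position of [t], and
    linearity preserves the match. The members of [U], shifted by [p], are added disjointly. *)
Lemma nonoverlapping_occurrences_step (Sg : signature) (V : eqType)
    (t s u : term Sg V) (S U : {fset position}) (p : position)
    (sigma : substitution Sg V) :
  linear_term t -> nonoverlapping_occurrences t s S -> p \in S ->
  (forall q, q \in S -> prefix p q -> q = p) ->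
  subterm s p = Some (subst sigma t) -> nonoverlapping_occurrences t u U ->
  exists2 S', nonoverlapping_occurrences t (replace s (subst sigma u) p) S' &
    #|` S'|%fset = (#|` S|%fset.-1 + #|` U|%fset)%N.
Proof.
move=> lin_t [occS novS] pS p_inner sp [occU novU].
have notpre q : q \in (S `\ p)%fset -> ~~ prefix p q.
  rewrite !inE => /andP[qp qS]; apply: contra qp => pq.
  by rewrite (p_inner _ qS pq).
exists ((S `\ p) `|` [fset p ++ q | q in U])%fset; last first.
  rewrite cardfsU.
  have -> : ((S `\ p) `&` [fset p ++ q | q in U] = fset0)%fset.
    apply/fsetP => q; rewrite in_fset0; apply/negbTE; rewrite inE.
    apply/negP => /andP[/notpre npq /imfsetP[r /= _ qE]].
    by move: npq; rewrite qE prefix_prefix.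
  rewrite cardfs0 subn0.
  rewrite [X in (_ + X)%N = _](card_imfset _ _ (@cat_injective _ p)).
  by rewrite (cardfsD1 p S) pS.
split.
- move=> q; rewrite in_fsetU => /orP[qS|/imfsetP[r /= rU ->]]; last first.
    have [tau urt] := occU _ rU; exists (subst_comp_fin sigma tau).
    by rewrite (subterm_replace _ _ sp) (subterm_subst _ urt) subst_comp.
  have npq := notpre _ qS.
  move: qS; rewrite !inE => /andP[qp qS].
  have [tau sq] := occS _ qS.
  have [/prefixP[r pE]|nqp] := boolP (prefix q p); last first.
    by exists tau; rewrite subterm_replace_parallel.
  have nr : ~ PosSigma t r.
    move=> tr; apply: (novS p q pS qS) => [/esym/eqP|]; first exact/negP.
    by exists r => //; left.
  have [tau' tau'E _] := replace_linear_match tau (subst sigma u) lin_t nr.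
  by exists tau'; rewrite pE subterm_replace_above sq /= tau'E.
(* An old [q] overlapping a new [p ++ r] must lie above [p]; the function position of [t] reaching
   [p ++ r] then has a prefix reaching [p], so [q] already overlapped [p]. *)
- have cross q r : q \in (S `\ p)%fset -> r \in U -> ~ overlapping t q (p ++ r).
    move=> qS rU [w tw]; have npq := notpre _ qS.
    move: qS; rewrite !inE => /andP[qp qS] [qE|prE].
      by move: npq; rewrite qE -catA prefix_prefix.
    have /prefixP[a pE] : prefix q p.
      by move: (prefix_comparable prE); rewrite (negPf npq).
    have wE : w = a ++ r.
      by move: prE; rewrite pE -catA => /cat_injective.
    apply: (novS p q pS qS) => [/esym/eqP|]; first exact/negP.
    by exists a; [apply: (@PosSigma_cat _ _ _ _ r); rewrite -wE | left].
  have ovC q r : overlapping t q r -> overlapping t r q.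
    by move=> [w tw [E|E]]; exists w => //; [right|left].
  move=> q r; rewrite !in_fsetU.
  move=> /orP[qS|/imfsetP[q' /= q'U ->]] /orP[rS|/imfsetP[r' /= r'U ->]] qr.
  + by move: qS rS; rewrite !inE => /andP[_ qS] /andP[_ rS]; exact: novS.
  + exact: cross.
  + by move/ovC; exact: cross.
  + move=> [w tw E]; apply: (novU q' r' q'U r'U) => [E'|].
      by rewrite E' in qr.
    exists w => //; case: E; rewrite -catA => /cat_injective;
      by [left|right].
Qed.

(** * Iterating a rewrite sequence tree *)

(* [m] occurrences are pending; processing one of them along the leaf [v]
   consumes it and creates [w v] new ones. *)
Fixpoint walk (A : Type) (L : set A) (w : A -> nat) (m : nat) (ls : seq A)
    (m' : nat) : Prop :=
  match ls with
  | [::] => m = m'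
  | v :: ls' => [/\ (0 < m)%N, L v & walk L w (m.-1 + w v) ls' m']
  end.

Lemma walk_cat (A : Type) (L : set A) (w : A -> nat) m ls m' ls' m'' :
  walk L w m ls m' -> walk L w m' ls' m'' -> walk L w m (ls ++ ls') m''.
Proof.
elim: ls m => [|v ls IH] m /=; first by move=> ->.
by move=> [m0 Lv /IH mls] /mls.
Qed.

Section Compose.
Variables (R : realType) (Sg : signature) (V : eqType) (P : ptrs R Sg V).
(** Abstract data of the rounds: in state [x], [cnt x] occurrences are pending in the term [lab x],
    the next copy of [T] runs inside [ctx x], and its leaf [v] leads to [next x v]. *)
Variables (T : rst P) (X : Type) (x0 : X) (cnt : X -> nat).
Variables (lab : X -> term Sg V) (ctx : X -> term Sg V -> term Sg V).
Variables (next : X -> seq nat -> X) (w : seq nat -> nat).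
Hypothesis root_inner : ~ leaves T [::].
Hypothesis ctx_step : forall x s mu, (0 < cnt x)%N -> rstep P s mu ->
  rstep P (ctx x s) [seq (pr.1, ctx x pr.2) | pr <- mu].
Hypothesis ctx_root : forall x, (0 < cnt x)%N -> ctx x (node_term T [::]) = lab x.
Hypothesis next_lab : forall x v, (0 < cnt x)%N -> leaves T v ->
  lab (next x v) = ctx x (node_term T v).
Hypothesis next_cnt : forall x v, (0 < cnt x)%N -> leaves T v ->
  cnt (next x v) = ((cnt x).-1 + w v)%N.

(* [(x, q, v)]: the current round started in [x] with probability [q] and has
   reached the inner node [v] of [T]. *)
Let state : Type := (X * R * seq nat)%type.

(** A leaf of one copy is identified with the root of the next, so no node separates two rounds. The
    run gets stuck once nothing is pending. *)
Let step (st : state) (i : nat) : option state :=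
  let: (x, q, v) := st in
  if (0 < cnt x)%N && `[< nodes T (rcons v i) >] then
    if `[< leaves T (rcons v i) >] then
      Some (next x (rcons v i), q * node_prob T (rcons v i), [::])
    else Some (x, q, rcons v i)
  else None.

Let run (st : state) (u : seq nat) : option state :=
  foldl (fun o i => obind (step^~ i) o) (Some st) u.

Let run_rcons st u i : run st (rcons u i) = obind (step^~ i) (run st u).
Proof. by rewrite /run foldl_rcons. Qed.

Let run_cat st u u' : run st (u ++ u') = obind (run^~ u') (run st u).
Proof.
elim/last_ind: u' => [|u' i IH]; first by rewrite cats0; case: (run st u).
by rewrite -rcons_cat run_rcons IH; case: (run st u) => //= st'; rewrite run_rcons.
Qed.

Let valid (st : state) : Prop :=
  [/\ 0 < st.1.2 <= 1, nodes T st.2 & ~ leaves T st.2].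

Let step_valid st i st' : valid st -> step st i = Some st' -> valid st'.
Proof.
case: st => -[x q] v [/= /andP[q0 q1] Tv nlv].
case: ifPn => // /andP[_ /asboolP Tvi]; case: asboolP => [lvi|nlvi] [<-].
  have /andP[p0 p1] := rst_prob_range Tvi.
  split=> //=; last exact: rst_root.
  by rewrite mulr_gt0//= mulr_ile1// ltW.
by split=> //=; rewrite q0.
Qed.

Let run_valid st u st' : valid st -> run st u = Some st' -> valid st'.
Proof.
move=> ok; elim/last_ind: u st' => [|u i IH] st'; first by case=> <-.
rewrite run_rcons; case E: (run st u) => [st''|//] /=; exact/step_valid/IH.
Qed.

Let inner_child v : nodes T v -> ~ leaves T v -> exists i, nodes T (rcons v i).
Proof.
move=> Tv nl; apply: contrapT => nex; apply: nl; split=> // i Ti.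
by apply: nex; exists i.
Qed.

Let st0 : state := (x0, 1, [::]).

Let st0_valid : valid st0.
Proof. by split=> //=; [rewrite ltr01 lexx | exact: rst_root]. Qed.

Let cnodes : set (seq nat) := [set u | run st0 u].
Let cprob (u : seq nat) : R :=
  if run st0 u is Some (_, q, v) then q * node_prob T v else 0.
Let cterm (u : seq nat) : term Sg V :=
  if run st0 u is Some (x, _, v) then
    (* [ctx x] is specified only while an occurrence is pending; a finished state is labeled
       directly. *)
    if (0 < cnt x)%N then ctx x (node_term T v) else lab x
  else lab x0.

Let cparent u i : cnodes (rcons u i) -> cnodes u.
Proof. by rewrite /cnodes /= run_rcons; case: (run st0 u). Qed.

Let cprob_range u : cnodes u -> 0 < cprob u <= 1.
Proof.
rewrite /cnodes /cprob /=; case E: (run st0 u) => [[[x q] v]|//] _.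
have [/= /andP[q0 q1] Tv _] := run_valid st0_valid E.
have /andP[p0 p1] := rst_prob_range Tv.
by rewrite mulr_gt0//= mulr_ile1// ltW.
Qed.

Let cprob_root : cprob [::] = 1.
Proof. by rewrite /cprob /= mul1r rst_prob_root. Qed.

(** The children are those of the inner node [v] of [T], and [ctx_step] transports the rewrite step
    there. The common factor [q] cancels in the quotients. *)
Let cstep u : cnodes u -> (exists i, cnodes (rcons u i)) ->
  exists2 k : nat,
    (forall i, cnodes (rcons u i) <-> (i < k)%N) &
    rstep P (cterm u)
      [seq (cprob (rcons u i) / cprob u, cterm (rcons u i)) | i <- iota 0 k].
Proof.
rewrite /cnodes /=; case E: (run st0 u) => [[[x q] v]|//] _ [i0].
rewrite run_rcons E /=; case: ifP => // /andP[x0' /asboolP Tvi0] _.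
have [/= /andP[q0 q1] Tv nlv] := run_valid st0_valid E.
have [k kP stepP] := rst_step Tv (inner_child Tv nlv).
have runE i : run st0 (rcons u i) = step (x, q, v) i by rewrite run_rcons E.
exists k => [i|].
  rewrite runE /= x0' /= -kP; case: asboolP => //.
  by case: asboolP.
rewrite {1}/cterm E x0'.
have := ctx_step x0' stepP; rewrite -map_comp.
congr (rstep _ _ _); apply/eq_in_map => i; rewrite mem_iota /= add0n => ik.
have Tvi : nodes T (rcons v i) by apply/kP.
have pv0 : 0 < node_prob T v by have /andP[] := rst_prob_range Tv.
rewrite /cterm /cprob runE E /= x0' /=.
case: asboolP => //= _; case: asboolP => [lvi|nlvi]; last first.
  by rewrite x0' -mulf_div divff ?mul1r// gt_eqF.
(* At a leaf the new round sits at the root of [T], whose probability is 1, and its label is the one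
   expected by [next_lab]. *)
rewrite rst_prob_root mulr1 -mulf_div divff ?mul1r ?gt_eqF//.
by case: ifP => [/ctx_root ->|_]; rewrite next_lab.
Qed.

Let compose_rst : rst P :=
  @RST _ _ _ P cnodes cprob cterm isT cparent cprob_range cprob_root cstep.

Let run_path x q v u : (0 < cnt x)%N -> nodes T (v ++ u) ->
  ~ leaves T (v ++ u) -> run (x, q, v) u = Some (x, q, v ++ u).
Proof.
move=> cx; elim/last_ind: u => [|u i IH]; first by rewrite cats0.
rewrite run_rcons -rcons_cat => Ti nli.
have Tvu : nodes T (v ++ u) := rst_parent Ti.
rewrite (IH Tvu) /=; last by move=> [_ /(_ i)].
by rewrite cx asboolT//= asboolF.
Qed.

Let run_leaf x q v : (0 < cnt x)%N -> leaves T v ->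
  run (x, q, [::]) v = Some (next x v, q * node_prob T v, [::]).
Proof.
move=> cx; case/lastP: v => [//|v i] lvi.
have [Tvi _] := lvi.
rewrite run_rcons run_path//=; last by move=> [_ /(_ i)].
  by rewrite cx !asboolT.
exact: rst_parent Tvi.
Qed.

Let run_walk x q ls : walk (leaves T) w (cnt x) ls 0 -> exists2 x', cnt x' = 0%N &
  run (x, q, [::]) (flatten ls) =
    Some (x', q * \prod_(v <- ls) node_prob T v, [::]).
Proof.
elim: ls x q => [|v ls IH] x q /=; first by exists x; rewrite // big_nil mulr1.
move=> [cx lv]; rewrite -next_cnt// => /IH => /(_ (q * node_prob T v)).
move=> [x' cx' E]; exists x' => //.
by rewrite run_cat run_leaf//= E big_cons mulrA.
Qed.

(** Any reachable node splits into completed rounds [ls] followed by a partial path [v] in the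
    current copy. *)
Let walk_run x q u x' q' v : run (x, q, [::]) u = Some (x', q', v) ->
  exists ls, [/\ walk (leaves T) w (cnt x) ls (cnt x'), u = flatten ls ++ v &
    cnt x' = 0%N -> v = [::]].
Proof.
elim/last_ind: u x' q' v => [|u i IH] x' q' v.
  by case=> <- _ <-; exists [::].
rewrite run_rcons; case E: (run _ u) => [[[y r] v']|//] /=.
have [ls [wls -> _]] := IH _ _ _ E.
case: ifP => // /andP[cy /asboolP Ti]; case: asboolP => [li|nli] [<- _ <-].
  exists (rcons ls (rcons v' i)); split=> //.
    rewrite -cats1; apply: walk_cat wls _; rewrite /= next_cnt//.
  by rewrite flatten_rcons cats0 rcons_cat.
exists ls; split=> //; first by rewrite rcons_cat.
by move=> cy0; rewrite cy0 in cy.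
Qed.

(** While something is pending, the run is at an inner node of [T] and can continue; hence it stops
    exactly when the count reaches 0, at the end of a round. *)
Lemma compose_rst_exists : exists T' : rst P,
  leaves T' = flatten @` [set ls | walk (leaves T) w (cnt x0) ls 0%N] /\
  forall ls, walk (leaves T) w (cnt x0) ls 0%N ->
    node_prob T' (flatten ls) = \prod_(v <- ls) node_prob T v.
Proof.
exists compose_rst; split=> [|ls /(@run_walk _ 1)[x' _ E]]; last first.
  by rewrite /= /cprob E mul1r rst_prob_root mulr1.
apply/seteqP; split=> [u [/= Tu nlu]|_ [ls /= wls <-]].
  move: Tu nlu; rewrite /cnodes /=; case E: (run st0 u) => [[[x q] v]|//] _ nlu.
  have [_ /= Tv nlv] := run_valid st0_valid E.
  have [ls [wls uE v0]] := walk_run E.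
  have cx : cnt x = 0%N.
    apply/eqP; rewrite -leqn0 leqNgt; apply/negP => cx.
    have [i Ti] := inner_child Tv nlv.
    apply: (nlu i); rewrite run_rcons E /= cx asboolT//=.
    by case: asboolP.
  by exists ls; rewrite -?cx// uE v0// cats0.
have [x' cx' E] := @run_walk _ 1 _ wls.
split=> /=; first by rewrite /cnodes /= E.
by move=> i; rewrite /cnodes /= run_rcons E /= cx'.
Qed.

End Compose.

(** * Unique decoding of concatenated leaves *)

Lemma nodes_prefix (R : realType) (Sg : signature) (V : eqType)
    (P : ptrs R Sg V) (T : rst P) (u v : seq nat) :
  nodes T (u ++ v) -> nodes T u.
Proof.
elim/last_ind: v => [|v i IH]; first by rewrite cats0.
by rewrite -rcons_cat => /rst_parent.
Qed.

Lemma leaves_prefix_free (R : realType) (Sg : signature) (V : eqType)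
    (P : ptrs R Sg V) (T : rst P) (u v a b : seq nat) :
  leaves T u -> leaves T v -> u ++ a = v ++ b -> u = v.
Proof.
have pref u' v' : leaves T u' -> leaves T v' -> prefix u' v' -> u' = v'.
  move=> [_ nu] [Tv _] /prefixP[[|i c] E]; first by rewrite E cats0.
  by case: (nu i); apply: (@nodes_prefix _ _ _ _ _ _ c); rewrite cat_rcons -E.
move=> lu lv /prefix_comparable/orP[|]; first exact: pref.
by move/pref => ->.
Qed.

(** The leaves of [T] form a prefix code, and a walk cannot continue after reaching 0. Sums over
    leaves of the iterated tree thereby become sums over walks. *)
Lemma flatten_leaves_inj (R : realType) (Sg : signature) (V : eqType)
    (P : ptrs R Sg V) (T : rst P) (w : seq nat -> nat) (m : nat) :
  set_inj [set ls | walk (leaves T) w m ls 0%N] flatten.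
Proof.
move=> ls ls'; rewrite !inE /=; elim: ls ls' m => [|u ls IH] [|v ls'] m //=.
- by move=> -> [].
- by move=> [m0 _ _] m0'; rewrite m0' in m0.
- move=> [_ lu wls] [_ lv wls'] E; have uv := leaves_prefix_free lu lv E.
  rewrite uv in wls E *; congr (_ :: _); apply: IH wls wls' _.
  exact: cat_injective E.
Qed.

(** Each round adds at least one letter, so depth bounds the number of rounds from above. *)
Lemma size_flatten_ge (A : Type) (ls : seq (seq A)) (L : set (seq A)) w m m' :
  ~ L [::] -> walk L w m ls m' -> (size ls <= size (flatten ls))%N.
Proof.
move=> L0; elim: ls m => //= u ls IH m [_ Lu /IH ih].
by rewrite size_cat; case: u Lu => // a u _; rewrite -add1n leq_add.
Qed.

(** * Sums over walks *)

(** Finite partial sums give one inequality; applying it with the factor [c^-1] gives the other. *)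
Lemma esumZl (R : realType) (A : choiceType) (S : set A) (c : R) (a : A -> \bar R) :
  0 <= c -> (forall i, S i -> (0 <= a i)%E) ->
  (\esum_(i in S) (c%:E * a i) = c%:E * \esum_(i in S) a i)%E.
Proof.
have le (k : R) (b : A -> \bar R) : 0 <= k -> (forall i, S i -> (0 <= b i)%E) ->
    (\esum_(i in S) (k%:E * b i) <= k%:E * \esum_(i in S) b i)%E.
  move=> k0 b0; apply: ge_ereal_sup => _ [F [finF FS] <-].
  rewrite fsbig_finite//= big_seq -ge0_sume_distrr; last first.
    by move=> i; rewrite in_fset_set// inE => /FS/b0.
  rewrite -big_seq; apply: lee_wpmul2l; first by rewrite lee_fin.
  by apply: esum_ge; exists F => //; rewrite fsbig_finite.
rewrite le_eqVlt => /orP[/eqP <- _|c0 a0].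
  by rewrite mul0e esum1// => i _; rewrite mul0e.
apply/eqP; rewrite eq_le le ?(ltW c0)//=.
rewrite muleC -lee_pdivlMr// muleC.
have cVa i : (a i = c^-1%:E * (c%:E * a i))%E.
  by rewrite muleA -EFinM mulVf ?gt_eqF// mul1e.
under eq_esum do rewrite cVa.
apply: le; first by rewrite invr_ge0 ltW.
by move=> i /a0 ai0; rewrite mule_ge0// lee_fin ltW.
Qed.

Lemma le_esum_inj (R : realType) (A B : choiceType) (Q : set A) (S : set B)
    (f : A -> B) (a : B -> \bar R) :
  set_inj Q f -> (forall x, Q x -> S (f x)) -> (forall y, S y -> (0 <= a y)%E) ->
  (\esum_(x in Q) a (f x) <= \esum_(y in S) a y)%E.
Proof.
move=> finj QS a0; rewrite -esum_image//.
rewrite [leRHS](esumID (f @` Q))//.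
have -> : S `&` (f @` Q) = f @` Q.
  by apply/setIidPr => _ [x Qx <-]; exact: QS.
by rewrite leeDl// esum_ge0// => y [/a0].
Qed.

Section Walk.
Variables (R : realType) (A : choiceType) (L : set A) (p : A -> R) (w : A -> nat).
Hypothesis p_ge0 : forall v, L v -> 0 <= p v.

(** First passages to 0: [walk] demands a positive count before every step. *)
Let H (m : nat) : set (seq A) := [set ls | walk L w m ls 0].
Let W (ls : seq A) : R := \prod_(v <- ls) p v.

Lemma walk_prod_ge0 m ls m' : walk L w m ls m' -> 0 <= \prod_(v <- ls) p v.
Proof.
elim: ls m => [|v ls IH] m /=; first by rewrite big_nil.
by move=> [_ Lv /IH W0]; rewrite big_cons mulr_ge0// p_ge0.
Qed.

Let W_ge0 m ls : H m ls -> 0 <= W ls.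
Proof. exact: walk_prod_ge0. Qed.

Lemma walk_prefix_free m a a' b b' :
  walk L w m a 0 -> walk L w m a' 0 -> a ++ b = a' ++ b' -> a = a'.
Proof.
elim: a a' m => [|u a IH] [|u' a'] m //=.
- by move=> -> [].
- by move=> [m0 _ _] m0'; rewrite m0' in m0.
- move=> [_ _ wa] [_ _ wa'] [uu' E]; rewrite -uu' in wa' *; congr cons.
  exact: IH wa wa' E.
Qed.

(** The [k] additional pending items wait below the walk and keep every count positive. *)
Lemma walk_addl k m ls m' : walk L w m ls m' -> walk L w (m + k) ls (m' + k).
Proof.
elim: ls m => [|v ls IH] m /=; first by move=> ->.
case: m => [[]//|m] [_ Lv /IH wls]; split; rewrite ?addn_gt0//=.
by rewrite addnAC.
Qed.

(** The hypothesis makes [theta ^+ count] a supermartingale, so its initial value bounds the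
    probability of hitting 0. *)
Lemma esum_walk_le (theta : R) m : 0 <= theta ->
  (\esum_(v in L) (p v * theta ^+ w v)%:E <= theta%:E)%E ->
  (\esum_(ls in H m) (W ls)%:E <= (theta ^+ m)%:E)%E.
Proof.
move=> theta0 thetaP.
(* A finite subfamily has bounded length, which permits induction on [N]. *)
suff bounded N k : (\esum_(ls in [set ls | H k ls /\ (size ls <= N)%N])
    (W ls)%:E <= (theta ^+ k)%:E)%E.
  apply: ge_ereal_sup => _ [F [finF FH] <-].
  apply: le_trans (bounded (\max_(ls <- fset_set F) size ls)%N m).
  apply: esum_ge; exists F => //; split=> // ls Fls; split; first exact: FH.
  by apply: leq_bigmax_seq => //; rewrite in_fset_set// inE.
have H0E n : [set ls | H 0 ls /\ (size ls <= n)%N] = [set [::]].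
  by apply/seteqP; split=> [[|v ls] [h _]|_ ->] //; case: h.
elim: N k => [|N IH] [|k].
- by rewrite H0E esum_set1 /W big_nil// lee_fin.
- rewrite (_ : [set _ | _] = set0) ?esum_set0 ?lee_fin ?exprn_ge0//.
  by apply/seteqP; split=> // -[|v ls] [].
- by rewrite H0E esum_set1 /W big_nil// lee_fin.
pose J v := [set ls | H (k + w v) ls /\ (size ls <= N)%N].
have -> : [set ls | H k.+1 ls /\ (size ls <= N.+1)%N] =
    (fun vl => vl.1 :: vl.2) @` (L `*`` J).
  apply/seteqP; split=> [[|v ls] [//= [_ Lv wls] sz]|_ [[v ls] /= [Lv [wls sz]] <-]].
    by exists (v, ls).
  by split.
rewrite esum_image; last by move=> [v ls] [v' ls'] _ _ /= [-> ->].
under eq_esum do rewrite /W big_cons.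
rewrite -(esum_esum (J := J) (a := fun v ls => (p v * W ls)%:E)); last first.
  by move=> v ls Lv [wls _]; rewrite lee_fin mulr_ge0 ?p_ge0// (W_ge0 wls).
(* After the first step [v] the count is [k + w v]; the induction hypothesis bounds the tails by
   [theta ^+ k * theta ^+ w v]. *)
apply: (@le_trans _ _ (\esum_(v in L) ((theta ^+ k)%:E * (p v * theta ^+ w v)%:E))%E).
  apply: le_esum => v Lv; under eq_esum do rewrite EFinM.
  rewrite esumZl ?p_ge0//; last by move=> ls [wls _]; rewrite lee_fin (W_ge0 wls).
  rewrite -EFinM mulrCA -exprD EFinM; apply: lee_wpmul2l; last exact: IH.
  by rewrite lee_fin p_ge0.
rewrite esumZl ?exprn_ge0//; last first.
  by move=> v Lv; rewrite lee_fin mulr_ge0 ?p_ge0 ?exprn_ge0.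
by rewrite exprSr EFinM; apply: lee_wpmul2l; rewrite // lee_fin exprn_ge0.
Qed.

(** Bernoulli's bound is inserted into the increment [d * (1 - d) ^+ n] of the right-hand side. *)
Lemma one_sub_expr_ge (d : R) n : 0 <= d <= 1 ->
  n%:R * d - n%:R ^+ 2 * d ^+ 2 <= 1 - (1 - d) ^+ n.
Proof.
move=> /andP[d0 d1].
have bern k : 1 - k%:R * d <= (1 - d) ^+ k.
  elim: k => [|k IH]; first by rewrite mul0r subr0 expr0.
  have d1' : 0 <= 1 - d by rewrite subr_ge0.
  have k0 : 0 <= k%:R :> R by [].
  rewrite exprS -natr1; have := ler_wpM2l d1' IH.
  have := mulr_ge0 k0 (sqr_ge0 d); lra.
elim: n => [|n IH]; first by rewrite expr0; nra.
have n0 : 0 <= n%:R :> R by [].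
rewrite (exprS (1 - d)) -natr1; have := ler_wpM2l d0 (bern n).
have := mulr_ge0 n0 (sqr_ge0 d); have := sqr_ge0 d; lra.
Qed.

(* With [theta = 1 - d] and [theta^n <= 1 - n d + n^2 d^2], a finite part [F] of
   the sum with mean [M > 1] and second moment [K] suffices, provided that
   [d K <= M - 1]. *)
Lemma supercritical_fixpoint : (\esum_(v in L) (p v)%:E <= 1)%E ->
  (1 < \esum_(v in L) (p v * (w v)%:R)%:E)%E ->
  exists2 theta : R, 0 <= theta < 1 &
    (\esum_(v in L) (p v * theta ^+ w v)%:E <= theta%:E)%E.
Proof.
move=> p1 /ereal_sup_gt[_ [F [finF FL] <-]].
rewrite fsbig_finite//= sumEFin lte_fin; set M := \sum_(v <- _) _ => M1.
pose K := \sum_(v <- fset_set F) p v * (w v)%:R ^+ 2.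
have pF v : v \in fset_set F -> 0 <= p v.
  by rewrite in_fset_set// inE => /FL/p_ge0.
have K0 : 0 <= K.
  by rewrite /K big_seq sumr_ge0// => v /pF pv; rewrite mulr_ge0// exprn_ge0.
have KM : 0 < K + M by nra.
(* Having [M] in the denominator ensures [d <= 1] as well as [d * K <= M - 1]. *)
pose d := (M - 1) / (K + M).
have d01 : 0 < d <= 1.
  rewrite /d divr_gt0 ?subr_gt0//= ler_pdivrMr// mul1r; lra.
have dE : d * (K + M) = M - 1 by rewrite /d divfK// gt_eqF.
case/andP: d01 => d0 d1.
have t0 : 0 <= 1 - d by rewrite subr_ge0.
exists (1 - d); first by rewrite t0/= ltrBlDr ltrDl.
have t1 k : (1 - d) ^+ k <= 1 by apply: exprn_ile1 => //; rewrite lerBlDr lerDl ltW.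
(* As the total mass is at most 1, it suffices that the sum of [p v * (1 - theta ^+ w v)] is at
   least [d]. *)
rewrite EFinB leeBrDr//; apply: le_trans p1.
have -> : (\esum_(v in L) (p v)%:E = \esum_(v in L) (p v * (1 - d) ^+ w v)%:E +
    \esum_(v in L) (p v * (1 - (1 - d) ^+ w v))%:E)%E.
  rewrite -esumD.
  - by apply: eq_esum => v _; rewrite -EFinD -mulrDr subrKC mulr1.
  - by move=> v Lv; rewrite lee_fin mulr_ge0 ?p_ge0 ?exprn_ge0.
  - by move=> v Lv; rewrite lee_fin mulr_ge0 ?p_ge0 ?subr_ge0.
apply: leeD => //; apply: esum_ge; exists F => //.
rewrite fsbig_finite//= sumEFin lee_fin.
apply: (@le_trans _ _ (M * d - K * d ^+ 2)); first nra.
rewrite /M /K !mulr_suml -sumrB big_seq [leRHS]big_seq; apply: ler_sum => v vF.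
rewrite -[X in X - _]mulrA -[X in _ - X]mulrA -mulrBr.
apply: ler_wpM2l; first exact: pF.
by apply: one_sub_expr_ge; rewrite ltW.
Qed.

(* Hitting 0 from [m] is hitting the next lower level [m] times, so the expected
   hitting time [E] from 1 gives at least [m E] from [m]; conditioning on the
   first step then yields [E >= 1 + E]. *)
Lemma esum_walk_size : (1 <= \esum_(v in L) (p v)%:E)%E ->
  (1 <= \esum_(v in L) (p v * (w v)%:R)%:E)%E ->
  (1 <= \esum_(ls in H 1) (W ls)%:E)%E ->
  (\esum_(ls in H 1) ((size ls)%:R * W ls)%:E = +oo)%E.
Proof.
move=> p1 pw1 h1.
have e0 m ls : H m ls -> (0 <= ((size ls)%:R * W ls)%:E)%E.
  by move=> /W_ge0 ?; rewrite lee_fin mulr_ge0.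
have E0 : (0 <= \esum_(ls in H 1) ((size ls)%:R * W ls)%:E)%E.
  by apply: esum_ge0 => ls; exact: e0.
case eE : (\esum_(ls in H 1) _)%E => [E| |] //; last by rewrite eE in E0.
exfalso; have {}E0 : 0 <= E by rewrite -lee_fin -eE.
have WD a b : W (a ++ b) = W a * W b by rewrite /W big_cat.
(* A passage from 1, shifted up by [m], followed by one from [m] is a passage from [m.+1];
   prefix-freeness makes this concatenation injective. *)
have Himg m (g : seq A -> R) : (forall ls, H m.+1 ls -> 0 <= g ls) ->
    (\esum_(a in H 1) \esum_(b in H m) (g (a ++ b))%:E <=
     \esum_(ls in H m.+1) (g ls)%:E)%E.
  move=> g0.
  have catH a b : H 1 a -> H m b -> H m.+1 (a ++ b).
    move=> Ha Hb; apply: walk_cat Hb; have := walk_addl m Ha.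
    by rewrite add0n add1n.
  rewrite (esum_esum (J := fun=> H m) (a := fun a b => (g (a ++ b))%:E)); last first.
    by move=> a b Ha Hb; rewrite lee_fin g0//; exact: catH.
  apply: (le_esum_inj (f := fun ab => ab.1 ++ ab.2) (a := fun ls => (g ls)%:E)).
  - move=> [a b] [a' b']; rewrite !inE /= => -[Ha _] [Ha' _] /= ab.
    have aa' := walk_prefix_free Ha Ha' ab; rewrite aa' in ab *.
    by have -> := cat_injective ab.
  - by move=> [a b] [/= Ha Hb]; exact: catH.
  - by move=> ls Hls; rewrite lee_fin g0.
have h_ge1 m : (1 <= \esum_(ls in H m) (W ls)%:E)%E.
  elim: m => [|m IH].
    apply: esum_ge; exists [set [::]]; first by split=> //= ls ->.
    by rewrite fsbig_set1 /W big_nil.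
  apply: le_trans (Himg m W _); last by move=> ls; exact: W_ge0.
  apply: (le_trans h1); apply: le_esum => a Ha.
  under eq_esum do rewrite WD EFinM.
  rewrite esumZl ?(W_ge0 Ha)//; last by move=> b /W_ge0; rewrite lee_fin.
  by rewrite -[leLHS]mule1; apply: lee_wpmul2l; rewrite // lee_fin (W_ge0 Ha).
have e_ge m : ((m%:R * E)%:E <= \esum_(ls in H m) ((size ls)%:R * W ls)%:E)%E.
  elim: m => [|m IH]; first by rewrite mul0r; apply: esum_ge0 => ls; exact: e0.
  apply: le_trans (Himg m (fun ls => (size ls)%:R * W ls) _); last first.
    by move=> ls /e0; rewrite lee_fin.
  apply: (@le_trans _ _ (\esum_(a in H 1)
      (((size a)%:R * W a)%:E + ((m%:R * E)%:E * (W a)%:E)))%E).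
    rewrite esumD; first last.
    - by move=> a /W_ge0 Wa; rewrite -EFinM lee_fin !mulr_ge0.
    - by move=> a /e0.
    rewrite eE esumZl ?mulr_ge0//; last by move=> a /W_ge0; rewrite lee_fin.
    rewrite -natr1 mulrDl mul1r addrC EFinD; apply: leeD => //.
    by rewrite -[leLHS]mule1; apply: lee_wpmul2l; rewrite // lee_fin mulr_ge0.
  apply: le_esum => a Ha; have Wa := W_ge0 Ha.
  have sE b : ((size (a ++ b))%:R * W (a ++ b))%:E =
      (((size a)%:R * W a)%:E * (W b)%:E + (W a)%:E * ((size b)%:R * W b)%:E)%E.
    by rewrite -!EFinM -EFinD WD size_cat natrD; congr EFin; ring.
  under eq_esum do rewrite sE.
  rewrite esumD; first last.
  - by move=> b /e0 b0; rewrite mule_ge0// lee_fin.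
  - by move=> b /W_ge0 Wb; rewrite -EFinM lee_fin !mulr_ge0.
  rewrite !esumZl ?mulr_ge0//; first last.
  - by move=> b /e0.
  - by move=> b /W_ge0; rewrite lee_fin.
  apply: leeD; last by rewrite muleC; apply: lee_wpmul2l; rewrite ?lee_fin.
  by rewrite -[leLHS]mule1; apply: lee_wpmul2l; rewrite // lee_fin mulr_ge0.
suff : ((1 + E)%:E <= E%:E)%E by rewrite lee_fin; lra.
rewrite -[leRHS]eE.
(* First-step decomposition: a passage from 1 is a step [v] followed by a passage from [w v]. *)
apply: (@le_trans _ _ (\esum_(v in L) \esum_(ls in H (w v))
    ((size (v :: ls))%:R * W (v :: ls))%:E)%E); last first.
  rewrite (esum_esum (J := fun v => H (w v))
    (a := fun v ls => ((size (v :: ls))%:R * W (v :: ls))%:E)); last first.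
    move=> v ls Lv /W_ge0 Wls; rewrite lee_fin mulr_ge0// /W big_cons.
    by rewrite mulr_ge0 ?p_ge0.
  apply: (le_esum_inj (f := fun vl => vl.1 :: vl.2)
    (a := fun ls => ((size ls)%:R * W ls)%:E)).
  - by move=> [v ls] [v' ls'] _ _ /= [-> ->].
  - by move=> [v ls] [/= Lv Hls]; split.
  - by move=> ls; exact: e0.
(* The step itself contributes 1 and the remainder at least [w v * E]; both sums over [L] are at
   least 1. *)
apply: (@le_trans _ _ (\esum_(v in L) ((p v)%:E + E%:E * (p v * (w v)%:R)%:E))%E).
  rewrite esumD; first last.
  - by move=> v Lv; rewrite -EFinM lee_fin !mulr_ge0 ?p_ge0.
  - by move=> v Lv; rewrite lee_fin p_ge0.
  rewrite esumZl//; last by move=> v Lv; rewrite lee_fin mulr_ge0 ?p_ge0.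
  rewrite EFinD; apply: leeD => //.
  by rewrite -[leLHS]mule1; apply: lee_wpmul2l; rewrite // lee_fin.
apply: le_esum => v Lv; have pv := p_ge0 Lv.
have sE ls : ((size (v :: ls))%:R * W (v :: ls))%:E =
    ((p v)%:E * (W ls)%:E + (p v)%:E * ((size ls)%:R * W ls)%:E)%E.
  by rewrite -!EFinM -EFinD /W big_cons /= -natr1; congr EFin; ring.
under eq_esum do rewrite sE.
rewrite esumD; first last.
- by move=> b /e0 b0; rewrite mule_ge0// lee_fin.
- by move=> b /W_ge0 Wb; rewrite -EFinM lee_fin !mulr_ge0.
rewrite !esumZl//; first last.
- by move=> b /W_ge0; rewrite lee_fin.
- by move=> b /e0.
apply: leeD.
  by rewrite -[leLHS]mule1; apply: lee_wpmul2l; rewrite // lee_fin.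
rewrite [leLHS](_ : _ = (p v)%:E * ((w v)%:R * E)%:E)%E; last first.
  by rewrite -!EFinM; congr EFin; ring.
by apply: lee_wpmul2l; rewrite // lee_fin.
Qed.

End Walk.

(** * Iteration at innermost occurrences *)

(** The copy of [T] is instantiated by the substitution that matches [t] at an innermost pending
    position, so its root label is the subterm already there. *)
Lemma rst_round (R : realType) (Sg : signature) (V : eqType) (P : ptrs R Sg V)
    (T : rst P) (t s : term Sg V) (S : {fset position}) :
  linear_term t -> node_term T [::] = t -> nonoverlapping_occurrences t s S ->
  (0 < #|` S|%fset)%N ->
  exists ctx : term Sg V -> term Sg V,
  [/\ forall u mu, rstep P u mu ->
        rstep P (ctx u) [seq (pr.1, ctx pr.2) | pr <- mu],
      ctx (node_term T [::]) = s &
      forall v, exists2 S', nonoverlapping_occurrences t (ctx (node_term T v)) S' &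
        #|` S'|%fset = (#|` S|%fset.-1 + maxNO t (node_term T v))%N].
Proof.
move=> lin_t rootT occS /innermost_position[p pS p_inner].
have [sigma sp] := occS.1 _ pS.
exists (fun u => replace s (subst sigma u) p); split=> [u mu||v].
- exact: rstep_subst_ctx sp.
- by rewrite rootT replace_self.
have [U [_ occU novU] <-] := maxNO_attained t (node_term T v).
exact: (nonoverlapping_occurrences_step lin_t occS pS p_inner sp).
Qed.

Lemma iterated_rst (R : realType) (Sg : signature) (V : eqType)
    (P : ptrs R Sg V) (T : rst P) (t : term Sg V)
    (w := fun v => maxNO t (node_term T v))
    (H := [set ls | walk (leaves T) w 1 ls 0]) :
  linear_term t -> node_term T [::] = t -> ~ leaves T [::] ->
  exists T' : rst P, leaves T' = flatten @` H /\
    forall ls, H ls -> node_prob T' (flatten ls) = \prod_(v <- ls) node_prob T v.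
Proof.
move=> lin_t rootT root_inner.
pose X := {sS : term Sg V * {fset position} |
  nonoverlapping_occurrences t sS.1 sS.2}.
pose cnt (x : X) := #|` (sval x).2|%fset.
have roundP (x : X) : exists cn : (term Sg V -> term Sg V) * (seq nat -> X),
    (0 < cnt x)%N ->
    [/\ forall u mu, rstep P u mu ->
          rstep P (cn.1 u) [seq (pr.1, cn.1 pr.2) | pr <- mu],
        cn.1 (node_term T [::]) = (sval x).1 &
        forall v, (sval (cn.2 v)).1 = cn.1 (node_term T v) /\
          cnt (cn.2 v) = ((cnt x).-1 + w v)%N].
  (* Choice ranges over all states, so finished ones receive an arbitrary value. *)
  case: (posnP (cnt x)) => [->|cx]; first by exists (id, fun=> x).
  have [ctx [ctx_step ctx_root ctx_leaf]] := rst_round lin_t rootT (svalP x) cx.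
  have /choice[next nextP] v : exists y : X,
      (sval y).1 = ctx (node_term T v) /\ cnt y = ((cnt x).-1 + w v)%N.
    have [S' occS' cardS'] := ctx_leaf v.
    by exists (exist _ (ctx (node_term T v), S') occS').
  by exists (ctx, next).
have /choice[cn cnP] := roundP.
have occ0 : nonoverlapping_occurrences t t [fset [::]]%fset.
  split=> [p|p q]; last by rewrite !inE => /eqP -> /eqP ->.
  by rewrite inE => /eqP ->; exists (id_subst Sg V); rewrite subterm_nil subst_Var.
pose x0 : X := exist _ (t, [fset [::]]%fset) occ0.
have cnt0 : cnt x0 = 1%N by rewrite /cnt /= cardfs1.
rewrite /H -cnt0.
apply: (@compose_rst_exists _ _ _ _ _ _ x0 cnt (fun x => (sval x).1)
  (fun x => (cn x).1) (fun x => (cn x).2)) => //.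
- by move=> x s mu /cnP[+ _ _]; apply.
- by move=> x /cnP[].
- by move=> x v /cnP[_ _ /(_ v)[]].
- by move=> x v /cnP[_ _ /(_ v)[]].
Qed.

Theorem theorem10 (R : realType) (Sg : signature) (V : eqType)
    (P : ptrs R Sg V) (T : rst P) (t : term Sg V)
    (hT : (0 < height T)%E) (root_t : node_term T [::] = t)
    (lin_t : linear_term t) :
  ((1 < \esum_(v in leaves T)
          (node_prob T v * (maxNO t (node_term T v))%:R)%:E)%E -> ~ AST P) /\
  ((1 <= \esum_(v in leaves T)
          (node_prob T v * (maxNO t (node_term T v))%:R)%:E)%E -> ~ PAST P).
Proof.
(* Positive height yields a nonempty node, whose first letter is a child of the root. *)
have root_inner : ~ leaves T [::].
  move=> [_ leaf0].
  move: hT => /ereal_sup_gt[_ [[|i v] Tv <-]]; first by rewrite ltxx.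
  by move=> _; apply: (leaf0 i); apply: (@nodes_prefix _ _ _ _ T [:: i] v).
pose w v := maxNO t (node_term T v).
have [T' [leavesT' probT']] := iterated_rst lin_t root_t root_inner.
have flat_inj := @flatten_leaves_inj _ _ _ _ T w 1.
have convT' : conv_prob T' = (\esum_(ls in [set ls | walk (leaves T) w 1 ls 0])
    (\prod_(v <- ls) node_prob T v)%:E)%E.
  rewrite /conv_prob leavesT' esum_image//.
  by apply: eq_esum => ls Hls; rewrite probT'.
have p_ge0 v : leaves T v -> 0 <= node_prob T v.
  by move=> [/rst_prob_range/andP[/ltW]].
split=> [mean_gt1 ast|mean_ge1 past].
  have p1 : (\esum_(v in leaves T) (node_prob T v)%:E <= 1)%E.
    by rewrite -[leLHS]/(conv_prob T) ast.
  have [theta /andP[theta0 theta1] thetaP] :=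
    supercritical_fixpoint p_ge0 p1 mean_gt1.
  (* Under AST the hitting probability from 1 would be 1, yet it is at most [theta < 1]. *)
  have := esum_walk_le p_ge0 1 theta0 thetaP.
  by rewrite -convT' ast expr1 lee_fin leNgt theta1.
(* [edl] is infinite by definition when the mass is below 1, so PAST forces mass at least 1. *)
have past_conv (U : rst P) : (1 <= conv_prob U)%E.
  by have := past U; rewrite /edl leNgt; case: ifP => // _; rewrite ltxx.
have := past T'; rewrite /edl ifF; last by rewrite ltNge past_conv.
rewrite leavesT' esum_image//; apply/negP; rewrite -leNgt.
have h1 : (1 <= \esum_(ls in [set ls | walk (leaves T) w 1 ls 0])
    (\prod_(v <- ls) node_prob T v)%:E)%E by rewrite -convT' past_conv.
(* The expected number of rounds is infinite and bounds the expected leaf depth from below. *)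
rewrite -(esum_walk_size p_ge0 (past_conv T) mean_ge1 h1).
apply: le_esum => ls Hls; rewrite probT'// lee_fin.
apply: ler_wpM2r; first exact: (walk_prod_ge0 p_ge0 Hls).
by rewrite ler_nat (size_flatten_ge root_inner Hls).
Qed.
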